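(* For every ordinal $\alpha\in\{1,2,3,\dots\}\cup\{\omega\}\cup\{\omega+m\mid m=1,2,\dots\}\cup\{2\omega\}$, the $\alpha$-th hypercenter of $U_3$ is $$Z_\alpha(U_3)=\{(x_1+f_1(x_2,x_3),\,x_2,\,x_3)\mid f_1\in S_\alpha\}.$$
   Context: $K$ is a field of characteristic zero, $A_3=K\langle x_1,x_2,x_3\rangle$ the free associative $K$-algebra with unity. $U_3$ is the group of unitriangular automorphisms of $A_3$: all automorphisms $(x_1+f_1,\,x_2+f_2,\,x_3+f_3)$ (meaning $x_i\mapsto x_i+f_i$) with $f_1\in K\langle x_2,x_3\rangle$, $f_2\in K\langle x_3\rangle$, $f_3\in K$. Let $V$ be the group of automorphisms $\varphi=(x_2+g(x_3),\,x_3+h)$ of $K\langle x_2,x_3\rangle$ with $g\in K\langle x_3\rangle$, $h\in K$, and for $f\in K\langle x_2,x_3\rangle$ write $f^\varphi=f(x_2+g(x_3),x_3+h)$. Define subsets of $K\langle x_2,x_3\rangle$: $S_1=S=\{f\mid f^\varphi=f\text{ for all }\varphi\in V\}$; $S_{m+1}=\{f\mid f^\varphi-f\in S_m\text{ for all }\varphi\in V\}$ for $m\ge1$; $S_\omega=\bigcup_{m\ge1}S_m$; $S_{\omega+1}=\{f\mid f^\varphi-f\in S_\omega\ \forall\varphi\in V\}$; $S_{\omega+m+1}=\{f\mid f^\varphi-f\in S_{\omega+m}\ \forall\varphi\in V\}$ for $m\ge1$; $S_{2\omega}=\bigcup_{m\ge1}S_{\omega+m}$. Upper central series of a group $G$: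 $Z_0=1$; for successor ordinals $Z_k=\{g\in G\mid [g,h]\in Z_{k-1}\ \forall h\in G\}$; for limit ordinals $Z_\alpha=\bigcup_{\beta<\alpha}Z_\beta$; $\omega$ is the first infinite ordinal. *)

(* Defs.v *)
(* Free associative algebra K<x_1,x_2,...> over a field K,
   represented as finitely supported coefficient functions on words. *)
From HB Require Import structures.
From mathcomp Require Import all_boot all_order all_algebra.
From Stdlib Require Import ClassicalEpsilon.
Set Implicit Arguments. Unset Strict Implicit. Unset Printing Implicit Defensive.
Import Order.TTheory GRing.Theory Num.Theory.
Local Open Scope ring_scope.

Section NC.
Variable K : fieldType.

(* words = seq nat (letter i stands for the variable x_i);
   an element of the free algebra is its coefficient function *)
Definition ncpoly := seq nat -> K.

Definition finsupp (f : ncpoly) : Prop :=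
  exists s : seq (seq nat), forall w, f w != 0 -> w \in s.

Definition poly_in (vs : seq nat) (f : ncpoly) : Prop :=
  finsupp f /\ forall w, f w != 0 -> all (fun i => i \in vs) w.

Definition pzero : ncpoly := fun _ => 0.
Definition pconst (c : K) : ncpoly := fun w => if w == [::] then c else 0.
Definition pone : ncpoly := pconst 1.
Definition pvar (i : nat) : ncpoly := fun w => if w == [:: i] then 1 else 0.
Definition padd (f g : ncpoly) : ncpoly := fun w => f w + g w.
Definition psub (f g : ncpoly) : ncpoly := fun w => f w - g w.
Definition pscale (c : K) (f : ncpoly) : ncpoly := fun w => c * f w.
Definition pmul (f g : ncpoly) : ncpoly :=
  fun w => \sum_(i < (size w).+1) f (take i w) * g (drop i w).
Definition pprod (s : seq ncpoly) : ncpoly := foldr pmul pone s.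
Definition psum (s : seq ncpoly) : ncpoly := foldr padd pzero s.

Definition supp (f : ncpoly) : seq (seq nat) :=
  undup (epsilon (inhabits [::]) (fun s => forall w, f w != 0 -> w \in s)).

Definition subst (e : nat -> ncpoly) (f : ncpoly) : ncpoly :=
  psum [seq pscale (f w) (pprod (map e w)) | w <- supp f].

(* endomorphisms of A_3, given by the images of x_1, x_2, x_3 *)
Record Aut3 := mkAut3 { im1 : ncpoly; im2 : ncpoly; im3 : ncpoly }.

Definition env (a : Aut3) (i : nat) : ncpoly :=
  match i with 1 => im1 a | 2 => im2 a | 3 => im3 a | _ => pvar i end.

(* composition as maps: (a * b)(x) = a (b (x)) *)
Definition mul (a b : Aut3) : Aut3 :=
  mkAut3 (subst (env a) (im1 b)) (subst (env a) (im2 b)) (subst (env a) (im3 b)).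
Definition one : Aut3 := mkAut3 (pvar 1) (pvar 2) (pvar 3).

Definition in_U3 (a : Aut3) : Prop :=
  exists f1 f2 (c : K), poly_in [:: 2; 3] f1 /\ poly_in [:: 3] f2 /\
    a = mkAut3 (padd (pvar 1) f1) (padd (pvar 2) f2) (padd (pvar 3) (pconst c)).

Definition inv (a : Aut3) : Aut3 :=
  epsilon (inhabits one) (fun b => in_U3 b /\ mul a b = one).
Definition comm (a b : Aut3) : Aut3 := mul (mul (inv a) (inv b)) (mul a b).

Fixpoint Zfin (n : nat) : Aut3 -> Prop :=
  match n with
  | 0 => fun g => g = one
  | m.+1 => fun g => in_U3 g /\ forall h, in_U3 h -> Zfin m (comm g h)
  end.
Definition Zomega (g : Aut3) : Prop := exists n, Zfin n g.
Fixpoint Zop (m : nat) : Aut3 -> Prop :=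
  match m with
  | 0 => Zomega
  | k.+1 => fun g => in_U3 g /\ forall h, in_U3 h -> Zop k (comm g h)
  end.
Definition Z2omega (g : Aut3) : Prop := exists m, Zop m g.

(* the group V acting on K<x_2,x_3>: phi = (x_2 + g(x_3), x_3 + h) *)
Definition actV (g : ncpoly) (h : K) (f : ncpoly) : ncpoly :=
  subst (fun i => if i == 2 then padd (pvar 2) g
                  else if i == 3 then padd (pvar 3) (pconst h) else pvar i) f.

Definition inA2 (f : ncpoly) : Prop := poly_in [:: 2; 3] f.

Definition S1 (f : ncpoly) : Prop :=
  inA2 f /\ forall g h, poly_in [:: 3] g -> actV g h f = f.

Fixpoint Sfin (n : nat) : ncpoly -> Prop :=   (* S_n, n >= 1; Sfin 0 unused *)
  match n with
  | 0 => fun _ => False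
  | m.+1 =>
    match m with
    | 0 => S1
    | _ => fun f => inA2 f /\
             forall g h, poly_in [:: 3] g -> Sfin m (psub (actV g h f) f)
    end
  end.
Definition Somega (f : ncpoly) : Prop := exists m, (1 <= m)%N /\ Sfin m f.
Fixpoint Sop (m : nat) : ncpoly -> Prop :=
  match m with
  | 0 => Somega
  | k.+1 => fun f => inA2 f /\
             forall g h, poly_in [:: 3] g -> Sop k (psub (actV g h f) f)
  end.
Definition S2omega (f : ncpoly) : Prop := exists m, (1 <= m)%N /\ Sop m f.

End NC.

Inductive ord2w := OFin of nat | OOmegaPlus of nat | OTwoOmega.

Definition Zord (K : fieldType) (a : ord2w) : Aut3 K -> Prop :=
  match a with OFin n => Zfin n | OOmegaPlus m => Zop m | OTwoOmega => @Z2omega K end.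
Definition Sord (K : fieldType) (a : ord2w) : ncpoly K -> Prop :=
  match a with OFin n => Sfin n | OOmegaPlus m => Sop m | OTwoOmega => @S2omega K end.

(* Main.v *)
(* Modulo [x1 -> x1 + f] the group is V, whose centre consists of the shifts
   [x2 -> x2 + a]; and the commutator of [x1 -> x1 + f] with an automorphism
   inducing [phi] on K<x2, x3> is [x1 -> x1 + (f^(phi^-1) - f)].  Hence the upper
   central series follows the recursion of the sets S_alpha as long as no shift
   with [a != 0] enters it.  Commuting such a shift with
   [f = x2^2 x3 (x3 - 1) ... (x3 - m + 1)] gives an element that abelianizes to
   (2 a x2 - a^2) x3 (x3 - 1) ... (x3 - m + 1).  It is not in S_(omega+m):
   [m] differences along [x3 -> x3 + 1] reduce it to a multiple of 2 a x2 plus a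
   constant, a difference along [x2 -> x2 + x3 (x3 - 1) ... (x3 - n + 1)] produces
   a falling factorial of arbitrary degree [n], and a falling factorial of degree
   [n] does not vanish under [n] differences. *)
Require Import Defs.
From HB Require Import structures.
From mathcomp Require Import all_boot all_order all_algebra.
From mathcomp Require Import boolp.
From mathcomp Require Import ring.
From Stdlib Require ClassicalEpsilon.
Set Implicit Arguments. Unset Strict Implicit. Unset Printing Implicit Defensive.
Import Order.TTheory GRing.Theory Num.Theory.
(* MathComp also exports [one] and [mul]; the ones of [Defs] must win. *)
Import Defs.
Local Open Scope ring_scope.

(** * The free algebra as a MathComp algebra *)

Section NCAlgebra.
Variable K : fieldType.
Implicit Types (f g h : ncpoly K) (a : K) (w : seq nat).

HB.instance Definition _ := gen_eqMixin (ncpoly K).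
HB.instance Definition _ := gen_choiceMixin (ncpoly K).

Definition popp f : ncpoly K := fun w => - f w.

Fact paddA : associative (@padd K).
Proof. by move=> f g h; apply/funext => w; rewrite /padd addrA. Qed.
Fact paddC : commutative (@padd K).
Proof. by move=> f g; apply/funext => w; rewrite /padd addrC. Qed.
Fact padd0 : left_id (@pzero K) (@padd K).
Proof. by move=> f; apply/funext => w; rewrite /padd add0r. Qed.
Fact paddN : left_inverse (@pzero K) popp (@padd K).
Proof. by move=> f; apply/funext => w; rewrite /padd addNr. Qed.

HB.instance Definition _ := GRing.isZmodule.Build (ncpoly K) paddA paddC padd0 paddN.

Fact pscaleA a b f : pscale a (pscale b f) = pscale (a * b) f.
Proof. by apply/funext => w; rewrite /pscale mulrA. Qed.
Fact pscale1 : left_id 1 (@pscale K).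
Proof. by move=> f; apply/funext => w; rewrite /pscale mul1r. Qed.
Fact pscaleDr : right_distributive (@pscale K) +%R.
Proof. by move=> a f g; apply/funext => w; rewrite /pscale mulrDr. Qed.
Fact pscaleDl f : {morph (@pscale K)^~ f : a b / a + b}.
Proof. by move=> a b; apply/funext => w; rewrite /pscale mulrDl. Qed.

HB.instance Definition _ :=
  GRing.Zmodule_isLmodule.Build K (ncpoly K) pscaleA pscale1 pscaleDr pscaleDl.

Lemma ncaddE f g w : (f + g) w = f w + g w. Proof. by []. Qed.
Lemma ncscaleE a f w : (a *: f) w = a * f w. Proof. by []. Qed.

Lemma nc_sumE (I : Type) (r : seq I) (F : I -> ncpoly K) w :
  (\sum_(i <- r) F i) w = \sum_(i <- r) F i w.
Proof. by elim: r => [|i r IH]; rewrite ?big_nil // !big_cons ncaddE IH. Qed.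

(* Left derivative by the letter [i]; it turns the Cauchy product into a
   recursion on words. *)
Definition lder (i : nat) f : ncpoly K := fun w => f (i :: w).

Lemma pmul_nil f g : pmul f g [::] = f [::] * g [::].
Proof. by rewrite /pmul big_ord1. Qed.

Lemma pmul_cons f g i w :
  pmul f g (i :: w) = f [::] * g (i :: w) + pmul (lder i f) g w.
Proof. by rewrite /pmul big_ord_recl. Qed.

Lemma lder_pmul f g i : lder i (pmul f g) = f [::] *: lder i g + pmul (lder i f) g.
Proof. by apply/funext => w; rewrite /lder pmul_cons. Qed.

Fact pmulDl : left_distributive (@pmul K) +%R.
Proof.
move=> f g h; apply/funext => w; rewrite ncaddE /pmul -big_split /=.
by apply: eq_bigr => i _; rewrite mulrDl.
Qed.
Fact pmulDr : right_distributive (@pmul K) +%R.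
Proof.
move=> f g h; apply/funext => w; rewrite ncaddE /pmul -big_split /=.
by apply: eq_bigr => i _; rewrite mulrDr.
Qed.
Fact pscaleAl a f g : a *: pmul f g = pmul (a *: f) g.
Proof.
apply/funext => w; rewrite ncscaleE /pmul mulr_sumr.
by apply: eq_bigr => i _; rewrite mulrA.
Qed.
Fact pscaleAr a f g : a *: pmul f g = pmul f (a *: g).
Proof.
apply/funext => w; rewrite ncscaleE /pmul mulr_sumr.
by apply: eq_bigr => i _; rewrite mulrCA.
Qed.

(** Peeling off the first letter with the left derivative gives an induction on the word and avoids
    reindexing a double sum. *)
Fact pmulA : associative (@pmul K).
Proof.
move=> f g h; apply/funext => w.
elim: w f g h => [|i w IH] f g h; first by rewrite !pmul_nil mulrA.
rewrite !pmul_cons lder_pmul pmulDl -pscaleAl ncaddE ncscaleE -IH pmul_nil.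
by rewrite mulrDr addrA mulrA.
Qed.

Fact pmul1 : left_id (@pone K) (@pmul K).
Proof.
move=> f; apply/funext => w; rewrite /pmul big_ord_recl take0 drop0 mul1r.
by rewrite big1 ?addr0 // => i _; case: w i => [[] //|j w i]; rewrite mul0r.
Qed.

Fact pmulr1 : right_id (@pone K) (@pmul K).
Proof.
move=> f; apply/funext => w; elim: w f => [|i w IH] f.
  by rewrite pmul_nil mulr1.
by rewrite pmul_cons IH mulr0 add0r.
Qed.

Fact pone_neq0 : @pone K != pzero K.
Proof. by apply/eqP => /(congr1 (@^~ [::]))/eqP; rewrite oner_eq0. Qed.

(** The ring obtained is that of all noncommutative formal power series; polynomials are singled out
    by [finsupp], which therefore accompanies evaluation throughout. *)
HB.instance Definition _ :=
  GRing.Zmodule_isNzRing.Build (ncpoly K) pmulA pmul1 pmulr1 pmulDl pmulDr pone_neq0.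
HB.instance Definition _ := GRing.Lmodule_isLalgebra.Build K (ncpoly K) pscaleAl.
HB.instance Definition _ := GRing.Lalgebra_isAlgebra.Build K (ncpoly K) pscaleAr.

Lemma ncalgE a : pconst a = a%:A :> ncpoly K.
Proof.
by apply/funext => w; rewrite [RHS](_ : _ = a * pconst 1 w) // /pconst; case: eqP;
  rewrite ?mulr1 ?mulr0.
Qed.

Lemma psubE f g : psub f g = f - g.
Proof. by []. Qed.

(** * Monomials and finitely supported series *)

Definition monom w : ncpoly K := \prod_(i <- w) pvar K i.

Lemma monom_nil : monom [::] = 1.
Proof. by rewrite /monom big_nil. Qed.

Lemma monom_cons i w : monom (i :: w) = pvar K i * monom w.
Proof. by rewrite /monom big_cons. Qed.

Lemma monomE w u : monom w u = (u == w)%:R.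
Proof.
elim: w u => [|i w IH] u; first by rewrite /monom big_nil; case: u.
rewrite monom_cons; case: u => [|j u].
  by rewrite [LHS]pmul_nil mul0r.
rewrite [LHS]pmul_cons mul0r add0r eqseq_cons.
have [->|ne] := eqVneq j i.
  have ->: lder i (pvar K i) = 1.
    by apply/funext => v; rewrite /lder /pvar eqseq_cons eqxx; case: v.
  by rewrite [LHS](_ : _ = (1 * monom w) u) // mul1r IH.
have ->: lder j (pvar K i) = 0.
  by apply/funext => v; rewrite /lder /pvar eqseq_cons (negPf ne).
by rewrite [LHS](_ : _ = (0 * monom w) u) // mul0r.
Qed.

Lemma finsupp_sum s (c : seq nat -> K) : finsupp (\sum_(w <- s) c w *: monom w).
Proof.
exists s => w; apply: contraNT => ws.
rewrite nc_sumE big_seq big1 // => u us.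
rewrite ncscaleE monomE; case: eqP us ws => [->->//|]; by rewrite mulr0.
Qed.

Lemma nc_sum_monom s f : uniq s -> (forall w, f w != 0 -> w \in s) ->
  f = \sum_(w <- s) f w *: monom w.
Proof.
move=> us fs; apply/funext => w; rewrite nc_sumE.
under eq_bigr do rewrite ncscaleE monomE.
have [ws|ws] := boolP (w \in s).
  rewrite (bigD1_seq w) //= eqxx mulr1 big1 ?addr0 // => u.
  by rewrite eq_sym => /negPf->; rewrite mulr0.
rewrite big_seq big1 ?(eqP (contraNT (fs w) ws)) //.
by move=> u us'; case: eqP us' ws => [->->//|]; rewrite mulr0.
Qed.

Lemma finsupp_monom w : finsupp (monom w).
Proof.
by exists [:: w] => u; rewrite monomE inE; case: (u == w) => //; rewrite eqxx.
Qed.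

Lemma finsupp0 : finsupp (0 : ncpoly K).
Proof. by exists [::] => w; rewrite eqxx. Qed.
Lemma finsuppD f g : finsupp f -> finsupp g -> finsupp (f + g).
Proof.
move=> [s fs] [t gt]; exists (s ++ t) => w; rewrite mem_cat; apply: contraR.
rewrite negb_or ncaddE => /andP[/(contraNT (fs w))/eqP-> /(contraNT (gt w))/eqP->].
by rewrite addr0.
Qed.
Lemma finsuppZ a f : finsupp f -> finsupp (a *: f).
Proof.
move=> [s fs]; exists s => w afw; apply: fs; apply: contraNneq afw => fw0.
by rewrite ncscaleE fw0 mulr0.
Qed.

(** The list comes from [epsilon], so this is all that is known of it; words with zero coefficient
    may occur in it. *)
Lemma finsuppP f : finsupp f -> uniq (supp f) /\ forall w, f w != 0 -> w \in supp f.
Proof.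
move=> ff; split=> [|w]; rewrite /supp ?undup_uniq // mem_undup.
exact: (ClassicalEpsilon.epsilon_spec (inhabits [::])
          (fun s : seq (seq nat) => forall w, f w != 0 -> w \in s) ff w).
Qed.

Lemma finsupp_ind (vs : pred nat) (P : ncpoly K -> Prop) :
  P 0 ->
  (forall c w f, all vs w -> finsupp f -> P f -> P (c *: monom w + f)) ->
  forall f, finsupp f -> (forall w, f w != 0 -> all vs w) -> P f.
Proof.
move=> P0 PD f ff fv.
have [us fs] := finsuppP ff.
rewrite (nc_sum_monom us fs).
elim: (supp f) => [|w s IH]; rewrite ?big_nil // big_cons.
have [->|/fv vw] := eqVneq (f w) 0; first by rewrite scale0r add0r.
by apply: PD => //; apply: finsupp_sum.
Qed.

Lemma finsuppM f g : finsupp f -> finsupp g -> finsupp (f * g).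
Proof.
move=> [s fs] [t gt]; exists [seq u ++ v | u <- s, v <- t] => w.
apply: contraR => wst; apply/eqP; apply: big1 => i _.
have [->|/fs us] := eqVneq (f (take i w)) 0; first by rewrite mul0r.
have [->|/gt vt] := eqVneq (g (drop i w)) 0; first by rewrite mulr0.
by case/negP: wst; apply/allpairsP; exists (take i w, drop i w); rewrite /= cat_take_drop.
Qed.
Lemma finsupp_var i : finsupp (pvar K i).
Proof. by exists [:: [:: i]] => w; rewrite /pvar inE; case: (w == _) => //; rewrite eqxx. Qed.
Lemma finsupp1 : finsupp (1 : ncpoly K).
Proof. by rewrite -monom_nil; exact: finsupp_monom. Qed.

(** * Polynomials in a prescribed set of variables *)

Lemma poly_in_finsupp vs f : poly_in vs f -> finsupp f. Proof. by case. Qed.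

Lemma poly_in_ind vs (P : ncpoly K -> Prop) :
  P 0 ->
  (forall c w f, all (mem vs) w -> finsupp f -> P f -> P (c *: monom w + f)) ->
  forall f, poly_in vs f -> P f.
Proof. by move=> P0 PD f [ff fv]; apply: (finsupp_ind P0 PD). Qed.

Lemma poly_in0 vs : poly_in vs (0 : ncpoly K).
Proof. by split=> [|w]; [exact: finsupp0 | rewrite eqxx]. Qed.
Lemma poly_inD vs f g : poly_in vs f -> poly_in vs g -> poly_in vs (f + g).
Proof.
move=> [ff fv] [fg gv]; split=> [|w]; first exact: finsuppD.
have [fw0|/fv//] := eqVneq (f w) 0.
by rewrite ncaddE fw0 add0r => /gv.
Qed.
Lemma poly_inZ vs a f : poly_in vs f -> poly_in vs (a *: f).
Proof.
move=> [ff fv]; split=> [|w]; first exact: finsuppZ.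
by move=> afw; apply: fv; apply: contraNneq afw => fw0; rewrite ncscaleE fw0 mulr0.
Qed.
Lemma poly_inN vs f : poly_in vs f -> poly_in vs (- f).
Proof. by rewrite -scaleN1r; apply: poly_inZ. Qed.
Lemma poly_inB vs f g : poly_in vs f -> poly_in vs g -> poly_in vs (f - g).
Proof. by move=> ff fg; apply/poly_inD/poly_inN. Qed.
Lemma poly_inM vs f g : poly_in vs f -> poly_in vs g -> poly_in vs (f * g).
Proof.
move=> [ff fv] [fg gv]; split=> [|w]; first exact: finsuppM.
apply: contraR => wst; apply/eqP; apply: big1 => i _.
have [->|/fv us] := eqVneq (f (take i w)) 0; first by rewrite mul0r.
have [->|/gv vt] := eqVneq (g (drop i w)) 0; first by rewrite mulr0.
by case/negP: wst; rewrite -(cat_take_drop i w) all_cat us.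
Qed.
Lemma poly_in1 vs : poly_in vs (1 : ncpoly K).
Proof.
split; first exact: finsupp1.
by move=> w; rewrite -monom_nil monomE; case: w => //=; rewrite eqxx.
Qed.
Lemma poly_inA vs a : poly_in vs (a%:A : ncpoly K).
Proof. exact/poly_inZ/poly_in1. Qed.
Lemma poly_in_var (vs : seq nat) i : i \in vs -> poly_in vs (pvar K i).
Proof.
move=> vi; split; first exact: finsupp_var.
by move=> w; rewrite /pvar; case: (w =P [:: i]) => [->|_]; rewrite ?eqxx //= vi.
Qed.
Lemma poly_in_sub (vs vs' : seq nat) f :
  {subset vs <= vs'} -> poly_in vs f -> poly_in vs' f.
Proof. by move=> sub [ff fv]; split=> // w /fv; apply: sub_all. Qed.
Lemma poly_in_prod vs (I : Type) (r : seq I) (P : pred I) (F : I -> ncpoly K) :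
  (forall i, P i -> poly_in vs (F i)) -> poly_in vs (\prod_(i <- r | P i) F i).
Proof. by move=> FP; elim/big_ind: _ => //; [exact: poly_in1 | exact: poly_inM]. Qed.

(** * Evaluation homomorphisms *)

Section Eval.
Variable A : algType K.
Implicit Type v : nat -> A.

(** The target algebra is left open: with [ncpoly K] this is substitution, with [K^o] it is
    evaluation at a commutative point. *)
Definition nceval v f : A := \sum_(w <- supp f) f w *: \prod_(i <- w) v i.

(** Words with zero coefficient contribute nothing, so the uncontrolled list [supp f] can be traded
    for any convenient one; two series can then be summed over a common list. *)
Lemma ncevalE s v f : uniq s -> (forall w, f w != 0 -> w \in s) ->
  nceval v f = \sum_(w <- s) f w *: \prod_(i <- w) v i.
Proof.
move=> us fs; have [us' fs'] := finsuppP (ex_intro _ s fs).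
rewrite /nceval (bigID (fun w => f w == 0)) /= big1 ?add0r; last first.
  by move=> w /eqP->; rewrite scale0r.
rewrite [RHS](bigID (fun w => f w == 0)) /= [in RHS]big1 ?add0r; last first.
  by move=> w /eqP->; rewrite scale0r.
rewrite -big_filter -[RHS]big_filter; apply: perm_big; apply: uniq_perm.
- exact: filter_uniq.
- exact: filter_uniq.
move=> w; rewrite !mem_filter; case: eqP => //= /eqP fw.
by rewrite fs' ?fs.
Qed.

Lemma ncevalD v f g : finsupp f -> finsupp g ->
  nceval v (f + g) = nceval v f + nceval v g.
Proof.
move=> [s fs] [t gt]; pose r := undup (s ++ t).
have ur : uniq r by exact: undup_uniq.
have fr w : f w != 0 -> w \in r by move=> /fs; rewrite mem_undup mem_cat => ->.
have gr w : g w != 0 -> w \in r by move=> /gt; rewrite mem_undup mem_cat orbC => ->.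
rewrite !(@ncevalE r) //; first last.
  move=> w; have [fw0|/fr//] := eqVneq (f w) 0.
  by rewrite ncaddE fw0 add0r => /gr.
by rewrite -big_split /=; apply: eq_bigr => w _; rewrite ncaddE scalerDl.
Qed.

Lemma ncevalZ v a f : finsupp f -> nceval v (a *: f) = a *: nceval v f.
Proof.
move=> /finsuppP[us fs]; rewrite !(@ncevalE (supp f)) //; last first.
  by move=> w afw; apply: fs; apply: contraNneq afw => fw0; rewrite ncscaleE fw0 mulr0.
by rewrite scaler_sumr; apply: eq_bigr => w _; rewrite ncscaleE scalerA.
Qed.

Lemma ncevalB v f g : finsupp f -> finsupp g ->
  nceval v (f - g) = nceval v f - nceval v g.
Proof.
move=> ff fg; rewrite -scaleN1r ncevalD //; last exact: finsuppZ.
by rewrite ncevalZ // scaleN1r.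
Qed.

Lemma nceval0 v : nceval v 0 = 0.
Proof. by rewrite (@ncevalE [::]) ?big_nil // => w; rewrite eqxx. Qed.

Lemma nceval_monom v w : nceval v (monom w) = \prod_(i <- w) v i.
Proof.
rewrite (@ncevalE [:: w]) //; last first.
  by move=> u; rewrite monomE inE; case: (u == w) => //; rewrite eqxx.
by rewrite big_seq1 monomE eqxx scale1r.
Qed.

Lemma nceval1 v : nceval v 1 = 1.
Proof. by have := nceval_monom v [::]; rewrite /monom !big_nil. Qed.

Lemma nceval_var v i : nceval v (pvar K i) = v i.
Proof. by have := nceval_monom v [:: i]; rewrite /monom !big_seq1. Qed.

Lemma ncevalA v a : nceval v a%:A = a%:A.
Proof. by rewrite ncevalZ ?nceval1 //; exact: finsupp1. Qed.

(** Bilinearity reduces the claim to two monomials, whose product is the concatenation of words. *)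
Lemma ncevalM v f g : finsupp f -> finsupp g ->
  nceval v (f * g) = nceval v f * nceval v g.
Proof.
move=> ff fg; apply: (@finsupp_ind predT
  (fun f => nceval v (f * g) = nceval v f * nceval v g)) ff _; last first.
- by move=> w _; rewrite all_predT.
- move=> c w {}f _ ff IH; have fM : finsupp (c *: monom w).
    exact/finsuppZ/finsupp_monom.
  rewrite mulrDl !ncevalD ?IH ?mulrDl //; try exact: finsuppM.
  congr (_ + _); rewrite -scalerAl !ncevalZ -?scalerAl; try exact: finsupp_monom;
    last by apply: finsuppM => //; exact: finsupp_monom.
  congr (_ *: _); rewrite nceval_monom.
  apply: (@finsupp_ind predT
    (fun g => nceval v (monom w * g) = \prod_(i <- w) v i * nceval v g)) fg _.
  - by rewrite mulr0 !nceval0 mulr0.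
  - move=> d u {}g _ fg {}IH; rewrite mulrDr !ncevalD ?IH ?mulrDr //.
    + congr (_ + _); rewrite -scalerAr !ncevalZ -?scalerAr; try exact: finsupp_monom;
        last by apply: finsuppM; exact: finsupp_monom.
      by rewrite /monom -big_cat [X in _ *: X]nceval_monom nceval_monom big_cat.
    + exact/finsuppZ/finsupp_monom.
    + by apply: finsuppM; [|apply: finsuppZ]; exact: finsupp_monom.
    + by apply: finsuppM => //; exact: finsupp_monom.
  by move=> u _; rewrite all_predT.
by rewrite mul0r !nceval0 mul0r.
Qed.

Lemma eq_nceval (vs : seq nat) v v' f : poly_in vs f -> {in vs, v =1 v'} ->
  nceval v f = nceval v' f.
Proof.
move=> [_ fv] vv'; apply: eq_bigr => w _.
have [->|/fv/allP wv] := eqVneq (f w) 0; first by rewrite !scale0r.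
by congr (_ *: _); apply: eq_big_seq => i /wv/vv'.
Qed.

End Eval.

Lemma substE (e : nat -> ncpoly K) f : subst e f = nceval e f.
Proof.
rewrite /subst /nceval [psum _]foldrE big_map; apply: eq_bigr => w _.
by congr (_ *: _); rewrite [pprod _]foldrE big_map.
Qed.

Lemma nceval_vars f : finsupp f -> nceval (@pvar K) f = f.
Proof. by case/finsuppP=> us fs; rewrite {2}(nc_sum_monom us fs). Qed.

Lemma poly_in_nceval (vs vs' : seq nat) (e : nat -> ncpoly K) f :
  poly_in vs f -> {in vs, forall i, poly_in vs' (e i)} -> poly_in vs' (nceval e f).
Proof.
move=> [_ fv] ev; rewrite /nceval; elim/big_rec: _ => [|w g _ gP].
  exact: poly_in0.
apply: poly_inD => //; have [->|/fv/allP wv] := eqVneq (f w) 0.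
  by rewrite scale0r; exact: poly_in0.
apply: poly_inZ; rewrite big_seq; apply: poly_in_prod => i /wv; exact: ev.
Qed.

Lemma finsupp_nceval (e : nat -> ncpoly K) f :
  (forall i, finsupp (e i)) -> finsupp (nceval e f).
Proof.
move=> ev; rewrite /nceval; elim/big_rec: _ => [|w g _ gP]; first exact: finsupp0.
apply: finsuppD => //; apply: finsuppZ; elim/big_ind: _ => // [|? ? ? ?].
  exact: finsupp1.
exact: finsuppM.
Qed.

(** Both sides are linear and multiplicative in [f] and agree on letters; finiteness of each [e i]
    keeps the inner value a polynomial. *)
Lemma nceval_comp (A : algType K) (v : nat -> A) (e : nat -> ncpoly K) f :
  (forall i, finsupp (e i)) -> finsupp f ->
  nceval v (nceval e f) = nceval (fun i => nceval v (e i)) f.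
Proof.
move=> fe ff; apply: (@finsupp_ind predT (fun f => nceval v (nceval e f) =
   nceval (fun i => nceval v (e i)) f)) ff _; first by rewrite !nceval0.
- move=> c w {}f _ ff IH; have fM := finsuppZ c (finsupp_monom w).
  rewrite !ncevalD // -?IH; try exact: finsupp_nceval.
  congr (_ + _); rewrite !ncevalZ; try exact: finsupp_monom;
    try exact: finsupp_nceval.
  congr (_ *: _); rewrite !nceval_monom.
  elim: w {fM} => [|i w IHw]; first by rewrite !big_nil nceval1.
  rewrite !big_cons ncevalM ?IHw // -[X in finsupp X](nceval_monom e).
  exact: finsupp_nceval.
by move=> w _; rewrite all_predT.
Qed.

End NCAlgebra.

(** * Unitriangular automorphisms *)

Section Automorphisms.
Variable K : fieldType.
Implicit Types (f : ncpoly K) (a b c g h n : Aut3 K).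
Local Notation X := (@pvar K).

(** The record [Aut3] admits arbitrary series as images; this is the condition under which
    composition is associative. *)
Definition finaut a := forall i, finsupp (env a i).

Definition unitri f1 f2 (k : K) : Aut3 K := mkAut3 (X 1 + f1) (X 2 + f2) (X 3 + k%:A).

Definition elem1 f : Aut3 K := mkAut3 (X 1 + f) (X 2) (X 3).

Lemma in_U3P a : in_U3 a <->
  exists f1 f2 k, [/\ poly_in [:: 2; 3] f1, poly_in [:: 3] f2 & a = unitri f1 f2 k].
Proof.
split=> [[f1 [f2 [k [? [? ->]]]]]|[f1 [f2 [k [? ? ->]]]]];
  by exists f1, f2, k; rewrite /unitri -ncalgE.
Qed.

Lemma elem1E f : elem1 f = unitri f 0 0.
Proof. by rewrite /unitri scale0r !addr0. Qed.

Lemma in_U3_elem1 f : inA2 f -> in_U3 (elem1 f).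
Proof.
move=> fA; apply/in_U3P; exists f, 0, 0; split; rewrite ?elem1E //.
exact: poly_in0.
Qed.

Lemma elem1_inj : injective elem1.
Proof. by move=> f f' [/addrI]. Qed.

Lemma elem1_0 : elem1 0 = one K.
Proof. by rewrite /elem1 addr0. Qed.

Lemma aut_ext a b : env a =1 env b -> a = b.
Proof.
case: a b => [a1 a2 a3] [b1 b2 b3] e.
by have /= -> := e 1; have /= -> := e 2; have /= -> := e 3.
Qed.

Lemma env_one : env (one K) =1 X.
Proof. by case=> [|[|[|[|i]]]]. Qed.

Lemma env_mul a b i : env (mul a b) i = nceval (env a) (env b i).
Proof. by case: i => [|[|[|[|i]]]] /=; rewrite ?substE // nceval_var. Qed.

Lemma finaut_mul a b : finaut a -> finaut b -> finaut (mul a b).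
Proof. by move=> fa fb i; rewrite env_mul; apply: finsupp_nceval. Qed.

Lemma aut_mulA a b c : finaut a -> finaut b -> finaut c ->
  mul a (mul b c) = mul (mul a b) c.
Proof.
move=> fa fb fc; apply: aut_ext => i; rewrite !env_mul nceval_comp //.
by congr nceval; apply/funext => j; rewrite env_mul.
Qed.

Lemma aut_mul1 a : finaut a -> mul (one K) a = a.
Proof.
move=> fa; apply: aut_ext => i; rewrite env_mul.
by rewrite (_ : env _ = X) ?nceval_vars //; apply/funext/env_one.
Qed.

Lemma aut_mulr1 a : mul a (one K) = a.
Proof. by apply: aut_ext => i; rewrite env_mul env_one nceval_var. Qed.

Lemma finaut_unitri f1 f2 k : finsupp f1 -> finsupp f2 -> finaut (unitri f1 f2 k).
Proof.
move=> ff1 ff2 [|[|[|[|i]]]] /=; try apply: finsuppD => //; try exact: finsupp_var.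
exact/finsuppZ/finsupp1.
Qed.

Lemma finaut_U3 a : in_U3 a -> finaut a.
Proof.
case/in_U3P => f1 [f2 [k [/poly_in_finsupp ? /poly_in_finsupp ? ->]]].
exact: finaut_unitri.
Qed.

Lemma poly_in3_inA2 f : poly_in [:: 3] f -> inA2 f.
Proof. by apply: poly_in_sub => i; rewrite !inE orbC => ->. Qed.

Lemma poly_in_unitri3 f f1 f2 k :
  poly_in [:: 3] f -> poly_in [:: 3] (nceval (env (unitri f1 f2 k)) f).
Proof.
move=> fP; apply: (poly_in_nceval fP) => i; rewrite inE => /eqP-> /=.
by apply: poly_inD; [exact: poly_in_var | exact: poly_inA].
Qed.

Lemma inA2_unitri f f1 f2 k :
  inA2 f -> poly_in [:: 3] f2 -> inA2 (nceval (env (unitri f1 f2 k)) f).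
Proof.
move=> fP f2P; apply: (poly_in_nceval fP) => i.
rewrite !inE => /orP[] /eqP-> /=; apply: poly_inD; try exact: poly_in_var.
  exact: poly_in3_inA2.
exact: poly_inA.
Qed.

Lemma inA2_U3 f a : in_U3 a -> inA2 f -> inA2 (nceval (env a) f).
Proof. by case/in_U3P => f1 [f2 [k [_ ? ->]]] ?; apply: inA2_unitri. Qed.

(** * Products, inverses and commutators of unitriangular automorphisms *)

Lemma mul_unitri f1 f2 k (g1 g2 : ncpoly K) l :
  finsupp f1 -> finsupp f2 -> inA2 g1 -> poly_in [:: 3] g2 ->
  mul (unitri f1 f2 k) (unitri g1 g2 l) =
  unitri (f1 + nceval (env (unitri f1 f2 k)) g1)
         (f2 + nceval (env (unitri f1 f2 k)) g2) (k + l).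
Proof.
move=> ff1 ff2 /poly_in_finsupp fg1 /poly_in_finsupp fg2.
rewrite /mul /= !substE; congr mkAut3; rewrite ncevalD ?nceval_var ?ncevalA /= ?addrA //;
  try exact: finsupp_var; last exact/finsuppZ/finsupp1.
by rewrite scalerDl addrA.
Qed.

(** Back substitution: [b2] inverts [a] on [x3], and [b1] inverts it on [x2] and [x3]. Each new
    correction is minus the corresponding [f2] or [f1] composed with the partial inverse already
    built. *)
Lemma in_U3_rinv a : in_U3 a -> exists b, in_U3 b /\ mul a b = one K.
Proof.
case/in_U3P=> f1 [f2 [k [f1P f2P ->]]].
pose b2 := unitri 0 0 (- k).
pose g2 := - nceval (env b2) f2.
have g2P : poly_in [:: 3] g2 by apply/poly_inN/poly_in_unitri3.
pose b1 := unitri 0 g2 (- k).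
pose g1 := - nceval (env b1) f1.
have g1P : inA2 g1 by apply/poly_inN/inA2_unitri.
have ff1 := poly_in_finsupp f1P; have ff2 := poly_in_finsupp f2P.
have fg2 := poly_in_finsupp g2P; have f0 := finsupp0 K.
exists (unitri g1 g2 (- k)); split.
  by apply/in_U3P; exists g1, g2, (- k).
rewrite mul_unitri // subrr.
pose u := unitri f1 f2 k.
have fa : finaut u by apply: finaut_unitri.
have a3 : nceval (env u) (X 3 + (- k)%:A) = X 3.
  rewrite ncevalD ?nceval_var ?ncevalA /=; [|exact: finsupp_var|exact/finsuppZ/finsupp1].
  by rewrite scaleNr addrK.
have ag2 : nceval (env u) g2 = - f2.
  rewrite /g2 -scaleN1r ncevalZ ?scaleN1r; last first.
    by apply: finsupp_nceval => //; apply: finaut_unitri.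
  rewrite nceval_comp //; last by apply: finaut_unitri.
  congr (- _); rewrite -[RHS]nceval_vars //; apply: (eq_nceval f2P) => i.
  by rewrite inE => /eqP-> /=.
have ag1 : nceval (env u) g1 = - f1.
  rewrite /g1 -scaleN1r ncevalZ ?scaleN1r; last first.
    by apply: finsupp_nceval => //; apply: finaut_unitri.
  rewrite nceval_comp //; last by apply: finaut_unitri.
  congr (- _); rewrite -[RHS]nceval_vars //; apply: (eq_nceval f1P) => i.
  rewrite !inE => /orP[] /eqP-> //=.
  rewrite ncevalD ?nceval_var ?ag2 //=; last exact: finsupp_var.
  by rewrite addrK.
by rewrite -/u ag1 ag2 !subrr -elem1E elem1_0.
Qed.

Lemma inv_spec a : in_U3 a -> in_U3 (inv a) /\ mul a (inv a) = one K.
Proof.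
by move/in_U3_rinv; apply: (ClassicalEpsilon.epsilon_spec (inhabits (one K))
  (fun b => in_U3 b /\ mul a b = one K)).
Qed.

Lemma in_U3_inv a : in_U3 a -> in_U3 (inv a).
Proof. by case/inv_spec. Qed.

Lemma aut_mulrV a : in_U3 a -> mul a (inv a) = one K.
Proof. by case/inv_spec. Qed.

(** The choice of [inv] guarantees a right inverse only; since [inv a] has a right inverse too, the
    usual group argument makes it two-sided. *)
Lemma aut_mulVr a : in_U3 a -> mul (inv a) a = one K.
Proof.
move=> aU; have bU := in_U3_inv aU; have cU := in_U3_inv bU.
have [fa fb fc] := And3 (finaut_U3 aU) (finaut_U3 bU) (finaut_U3 cU).
rewrite -[LHS]aut_mulr1 -{1}(aut_mulrV bU) -aut_mulA //; last exact: finaut_mul.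
by rewrite [mul a _]aut_mulA // aut_mulrV // aut_mul1 // aut_mulrV.
Qed.

(** This removes the inverses chosen by [epsilon], leaving an equation that can be compared variable
    by variable. *)
Lemma comm_eqP g h n : in_U3 g -> in_U3 h -> finaut n ->
  comm g h = n <-> mul g h = mul (mul h g) n.
Proof.
move=> gU hU fn; rewrite /comm.
have gV := in_U3_inv gU; have hV := in_U3_inv hU.
have [fg fh fg' fh'] := And4 (finaut_U3 gU) (finaut_U3 hU) (finaut_U3 gV) (finaut_U3 hV).
have Vr : mul (mul h g) (mul (inv g) (inv h)) = one K.
  rewrite -aut_mulA ?[mul g _]aut_mulA ?aut_mulrV ?aut_mul1 ?aut_mulrV //.
  exact: finaut_mul.
have Vl : mul (mul (inv g) (inv h)) (mul h g) = one K.
  rewrite -aut_mulA ?[mul (inv h) _]aut_mulA ?aut_mulVr ?aut_mul1 ?aut_mulVr //.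
  exact: finaut_mul.
split=> [<-|->]; rewrite aut_mulA ?Vr ?Vl ?aut_mul1 //;
  by do ?apply: finaut_mul.
Qed.

Lemma inv_inv a : in_U3 a -> inv (inv a) = a.
Proof.
move=> aU; have bU := in_U3_inv aU; have cU := in_U3_inv bU.
have [fa fb fc] := And3 (finaut_U3 aU) (finaut_U3 bU) (finaut_U3 cU).
by rewrite -[LHS]aut_mul1 // -(aut_mulrV aU) -aut_mulA // aut_mulrV // aut_mulr1.
Qed.

Lemma nceval_elem1 f f' : inA2 f' -> nceval (env (elem1 f)) f' = f'.
Proof.
move=> f'P; rewrite -[RHS]nceval_vars; last exact: poly_in_finsupp f'P.
by apply: (eq_nceval f'P) => i; rewrite !inE => /orP[] /eqP->.
Qed.

(** Since [elem1 f] fixes [x2] and [x3], only the image of [x1] needs work; there [h] carries the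
    difference on the right to [f - nceval (env h) f], which is [hk]. *)
Lemma comm_elem1 f h : inA2 f -> in_U3 h ->
  comm (elem1 f) h = elem1 (nceval (env (inv h)) f - f).
Proof.
move=> fA hU; have hV := in_U3_inv hU.
have fhA := inA2_U3 hV fA.
have [fh fh'] := conj (finaut_U3 hU) (finaut_U3 hV).
have ff := poly_in_finsupp fA.
have kA := poly_inB fhA fA; have eU := in_U3_elem1 fA.
apply/(comm_eqP eU hU (finaut_U3 (in_U3_elem1 kA))).
case/in_U3P: (hU) => h1 [h2 [k [h1P h2P hE]]].
have h2A := poly_in3_inA2 h2P.
have hh : nceval (env h) (nceval (env (inv h)) f) = f.
  rewrite nceval_comp // -[RHS]nceval_vars //; congr nceval.
  by apply/funext => j; rewrite -env_mul aut_mulrV // env_one.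
have hk : nceval (env (mul h (elem1 f))) (nceval (env (inv h)) f - f) = f - nceval (env h) f.
  transitivity (nceval (env h) (nceval (env (inv h)) f - f)).
    apply: (eq_nceval kA) => j.
    by rewrite !inE => /orP[]/eqP->; rewrite env_mul /= nceval_var.
  by rewrite ncevalB ?hh //; exact: poly_in_finsupp fhA.
apply: aut_ext => i; rewrite !env_mul.
case: i => [|[|[|[|i]]]]; rewrite /= ?nceval_var ?env_mul /= ?nceval_var //.
- rewrite ncevalD; [|exact: finsupp_var|exact: poly_in_finsupp kA].
  rewrite hk nceval_var env_mul /= ncevalD //; last exact: finsupp_var.
  rewrite nceval_var hE /= ncevalD; [|exact: finsupp_var|exact: poly_in_finsupp h1P].
  by rewrite nceval_var nceval_elem1 //= -[RHS]addrA subrKC addrAC.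
- by rewrite hE /= nceval_elem1 //; apply: poly_inD => //; exact: poly_in_var.
- by rewrite hE /= nceval_elem1 //; apply: poly_inD; [exact: poly_in_var|exact: poly_inA].
Qed.

End Automorphisms.

(** * Commutative evaluation and the hypercenters *)

Section Evaluation.
Variable K : fieldType.
Implicit Types (f s : ncpoly K) (p : {poly K}) (x y a : K).
Local Notation X := (@pvar K).

(** Scalar values factor through the abelianization, where obstructions become identities between
    polynomial functions. The default 0 is never seen by elements of [inA2]. *)
Definition point x y (i : nat) : K^o := if i == 2 then x else if i == 3 then y else 0.

Definition ev x y f : K := nceval (point x y) f.

Lemma evD x y f s : finsupp f -> finsupp s -> ev x y (f + s) = ev x y f + ev x y s.
Proof. by move=> ff fs; rewrite /ev ncevalD. Qed.
Lemma evB x y f s : finsupp f -> finsupp s -> ev x y (f - s) = ev x y f - ev x y s.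
Proof. by move=> ff fs; rewrite /ev ncevalB. Qed.
Lemma evM x y f s : finsupp f -> finsupp s -> ev x y (f * s) = ev x y f * ev x y s.
Proof. by move=> ff fs; rewrite /ev ncevalM. Qed.
Lemma ev0 x y : ev x y 0 = 0.
Proof. by rewrite /ev nceval0. Qed.
Lemma ev_alg x y a : ev x y a%:A = a.
Proof. by rewrite /ev ncevalA; exact: mulr1. Qed.

(** The component [f1] is free because [x1] does not occur in [f]; so every element of [U3] acts on
    [K<x2, x3>] through [V]. *)
Lemma actV_unitri (g : ncpoly K) (k : K) f1 f : inA2 f ->
  actV g k f = nceval (env (unitri f1 g k)) f.
Proof.
move=> fA; rewrite /actV substE; apply: (eq_nceval fA) => i.
by rewrite !inE => /orP[] /eqP-> //=; rewrite -ncalgE.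
Qed.

Lemma ev_unitri x y f1 (g : ncpoly K) k f : inA2 f -> poly_in [:: 3] g ->
  ev x y (nceval (env (unitri f1 g k)) f) = ev (x + ev x y g) (y + k) f.
Proof.
move=> fA gP.
have -> : nceval (env (unitri f1 g k)) f = nceval (env (unitri 0 g k)) f.
  by apply: (eq_nceval fA) => i; rewrite !inE => /orP[] /eqP->.
have fg := poly_in_finsupp gP; rewrite /ev nceval_comp; last exact: poly_in_finsupp fA.
  apply: (@eq_nceval K K^o _ _ _ _ fA) => i; rewrite !inE => /orP[] /eqP-> /=; rewrite ncevalD //.
  - by rewrite nceval_var.
  - exact: finsupp_var.
  - by rewrite nceval_var ncevalA; congr (_ + _); exact: mulr1.
  - exact: finsupp_var.
  - exact/finsuppZ/finsupp1.
by apply: finaut_unitri => //; exact: finsupp0.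
Qed.

Lemma ev_actV x y (g : ncpoly K) k f : inA2 f -> poly_in [:: 3] g ->
  ev x y (actV g k f) = ev (x + ev x y g) (y + k) f.
Proof. by move=> fA gP; rewrite (actV_unitri _ _ 0) // ev_unitri. Qed.

Lemma inA2_actV (g : ncpoly K) k f : inA2 f -> poly_in [:: 3] g -> inA2 (actV g k f).
Proof. by move=> fA gP; rewrite (actV_unitri _ _ 0) //; apply: inA2_unitri. Qed.

Lemma poly_in_horner p : poly_in [:: 3] (horner_alg (X 3) p).
Proof.
elim/poly_ind: p => [|p c IH]; first by rewrite rmorph0; exact: poly_in0.
rewrite rmorphD rmorphM /= horner_algX horner_algC.
apply: poly_inD; last exact: poly_inA.
by apply: poly_inM => //; exact: poly_in_var.
Qed.

Lemma ev_horner x y p : ev x y (horner_alg (X 3) p) = p.[y].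
Proof.
elim/poly_ind: p => [|p c IH]; first by rewrite rmorph0 ev0 horner0.
have fp := poly_in_finsupp (poly_in_horner p); have fX := finsupp_var K 3.
rewrite rmorphD rmorphM /= horner_algX horner_algC hornerMXaddC.
rewrite evD ?evM ?IH ?ev_alg //; [|exact: finsuppM|exact/finsuppZ/finsupp1].
by rewrite /ev nceval_var.
Qed.

(** Words in a single letter are powers, so [K<x3>] is an ordinary polynomial ring and roots can be
    counted there. *)
Lemma poly_in_hornerP f : poly_in [:: 3] f -> exists p, f = horner_alg (X 3) p.
Proof.
move=> fP; apply: (poly_in_ind (P := fun f => exists p, f = horner_alg (X 3) p) _ _ fP).
  by exists 0; rewrite rmorph0.
move=> c w {fP}f wP _ [p ->].
suff [q ->] : exists q, monom K w = horner_alg (X 3) q.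
  by exists (c *: q + p); rewrite rmorphD /= linearZ /= mulr_algl.
elim: w wP => [|i w IH /andP[+ /IH[q qE]]].
  by exists 1; rewrite rmorph1 monom_nil.
rewrite /= inE => /eqP->; exists ('X * q).
by rewrite rmorphM /= horner_algX monom_cons qE.
Qed.

(** * Falling factorials *)

Definition ffpoly m : {poly K} := \prod_(i < m) ('X - i%:R%:P).

Lemma ffpolyS m y : (ffpoly m.+1).[y] = (ffpoly m).[y] * (y - m%:R).
Proof. by rewrite /ffpoly big_ord_recr /= hornerM !hornerE. Qed.

Lemma ffpoly0 y : (ffpoly 0).[y] = 1.
Proof. by rewrite /ffpoly big_ord0 hornerC. Qed.

Lemma ffpoly_shift m y : (ffpoly m.+1).[y + 1] = (y + 1) * (ffpoly m).[y].
Proof.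
elim: m => [|m IH]; first by rewrite ffpolyS !ffpoly0; ring.
rewrite ffpolyS IH ffpolyS -(addn1 m) natrD; ring.
Qed.

(** The unit difference acts on falling factorials as the derivative acts on powers. *)
Lemma ffpoly_diff m y : (ffpoly m.+1).[y + 1] - (ffpoly m.+1).[y] = m.+1%:R * (ffpoly m).[y].
Proof. by rewrite ffpoly_shift ffpolyS -(addn1 m) natrD; ring. Qed.

(** * Differences and the sets [S_alpha] in characteristic zero *)

Hypothesis charK0 : [pchar K] =i pred0.

Lemma natS_neq0 m : m.+1%:R != 0 :> K.
Proof. by rewrite (pcharf0P K).1. Qed.

(** The difference of the two sides vanishes at every natural number, and these are pairwise
    distinct in [K]. *)
Lemma shift_invariant_const p : (forall y, p.[y + 1] = p.[y]) -> p = (p.[0])%:P.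
Proof.
move=> pS; apply/eqP; rewrite -subr_eq0; apply: contraT => q0.
set q := p - _ in q0.
have qn (m : nat) : root q m%:R.
  rewrite rootE /q hornerD hornerN hornerC subr_eq0.
  by elim: m => // m /eqP<-; rewrite -(addn1 m) natrD pS.
(* A nonzero [q] has fewer than [size q] distinct roots, so [size q] of them already give a
   contradiction. *)
have := @max_poly_roots _ q [seq m%:R | m <- iota 0 (size q)] q0.
rewrite size_map size_iota ltnn; apply; first by apply/allP => z /mapP[m _ ->].
rewrite map_inj_uniq ?iota_uniq // => i j /eqP; wlog le_ij : i j / (i <= j)%N.
  by move=> W; case/orP: (leq_total i j) => /W // H; rewrite eq_sym => /H.
rewrite eq_sym -subr_eq0 -natrB // (pcharf0P K).1 // subn_eq0 => le_ji.
by apply/eqP; rewrite eqn_leq le_ij.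
Qed.

(** Starting at [{0}], the counterpart of [Z_0 = 1], makes the recursion uniform, whereas [Sfin 0]
    is empty and [S1] is a separate case. *)
Fixpoint Sdiff n f : Prop :=
  match n with
  | 0 => f = 0
  | m.+1 => inA2 f /\ forall g k, poly_in [:: 3] g -> Sdiff m (actV g k f - f)
  end.

Lemma SfinE n f : Sfin n.+1 f <-> Sdiff n.+1 f.
Proof.
elim: n f => [|n IH] f.
  split=> -[fA fS]; split=> // g k gP; first by rewrite /= fS // subrr.
  by apply/eqP; rewrite -subr_eq0; apply/eqP/fS.
by split=> -[fA fS]; split=> // g k /(fS _ k)/IH.
Qed.

Lemma Sdiff_inA2 n f : Sdiff n f -> inA2 f.
Proof. by case: n => [->|n []//]; exact: poly_in0. Qed.

(** A difference along [x3 -> x3 + 1] lowers both the level and the degree by one and multiplies [a]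
    by a nonzero integer. *)
Lemma Sdiff_ff n f a : Sdiff n f -> (forall x y, ev x y f = a * (ffpoly n).[y]) -> a = 0.
Proof.
elim: n f a => [|n IH] f a.
  by move=> -> /(_ 0 0); rewrite ev0 ffpoly0 mulr1.
move=> [fA fS] fE.
have f0 := poly_in0 K [:: 3].
apply/eqP; rewrite -[_ == 0]orbF -(negPf (natS_neq0 n)) -mulf_eq0; apply/eqP.
apply: (IH _ _ (fS 0 1 f0)) => x y.
rewrite evB ?ev_actV ?fE //.
- by rewrite -mulrA -ffpoly_diff mulrBr.
- exact/poly_in_finsupp/inA2_actV.
- exact: poly_in_finsupp fA.
Qed.

(** From level [n.+1], the difference along [x2 -> x2 + ffpoly n] lands in level [n] with value [a]
    times [ffpoly n], whose degree is just too large for that level. *)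
Lemma Sdiff_x2 n f a b : Sdiff n f -> (forall x y, ev x y f = a * x + b) -> a = 0.
Proof.
case: n => [->|n [fA fS]] fE.
  by have := fE 1 0; have := fE 0 0; rewrite !ev0 mulr0 add0r => <-; rewrite mulr1 addr0.
have gP := poly_in_horner (ffpoly n).
apply: (Sdiff_ff (fS _ 0 gP)) => x y.
rewrite evB ?ev_actV ?ev_horner ?fE //.
- by ring.
- exact/poly_in_finsupp/inA2_actV.
- exact: poly_in_finsupp fA.
Qed.

(** Zero already lies in [S1], so admitting level 0 does not enlarge the union. *)
Lemma Somega_Sdiff f : Somega f <-> exists n, Sdiff n f.
Proof.
split=> [[[|n] [] // _ /SfinE fS]|[[fS|n /SfinE fS]]]; first by exists n.+1.
  exists 1; split=> //; split; first by rewrite fS; exact: poly_in0.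
  by move=> g k _; rewrite fS /actV substE nceval0.
by exists n.+1.
Qed.

(** Unit differences in [x3] strip the falling factorial, scaling [a] and [b] by the same nonzero
    integer, until [Sdiff_x2] applies at a finite level. *)
Lemma Sop_x2 m f a b : Sop m f ->
  (forall x y, ev x y f = (a * x + b) * (ffpoly m).[y]) -> a = 0.
Proof.
elim: m f a b => [|m IH] f a b.
  by move=> /Somega_Sdiff[n /Sdiff_x2 fS] fE; apply: (fS _ b) => x y; rewrite fE ffpoly0 mulr1.
move=> [fA fS] fE; have f0 := poly_in0 K [:: 3].
apply/eqP; rewrite -[_ == 0]orbF -(negPf (natS_neq0 m)) -mulf_eq0; apply/eqP.
apply: (IH _ _ (b * m.+1%:R) (fS 0 1 f0)) => x y.
rewrite evB ?ev_actV ?fE //.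
- by rewrite ev0 addr0 -mulrBr ffpoly_diff; ring.
- exact/poly_in_finsupp/inA2_actV.
- exact: poly_in_finsupp fA.
Qed.

(* The obstruction that keeps [x2 -> x2 + a] out of the next hypercenter: [s] is
   the commutator of that automorphism with [x1 -> x1 + f]. *)
Definition shift_escapes (S : ncpoly K -> Prop) := forall a, a != 0 ->
  exists2 f, inA2 f &
    forall s, S s -> ~ (forall x y, ev x y s = ev x y f - ev (x - a) y f).

Lemma Sop_shift_escapes m : shift_escapes (Sop m).
Proof.
move=> a a0; pose f := X 2 * X 2 * horner_alg (X 3) (ffpoly m).
have hA := poly_in3_inA2 (poly_in_horner (ffpoly m)).
have X2A : inA2 (X 2) by exact: poly_in_var.
have fA : inA2 f by apply: poly_inM => //; apply: poly_inM.
have fE x y : ev x y f = x * x * (ffpoly m).[y].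
  have fX := poly_in_finsupp X2A; have fh := poly_in_finsupp hA.
  rewrite /f evM ?evM ?ev_horner //; last exact: finsuppM.
  by rewrite /ev nceval_var.
exists f => // s sS sE.
(* The identity [x^2 - (x - a)^2 = 2 a x - a^2] supplies both coefficients. *)
have /eqP : 2%:R * a = 0.
  by apply: (Sop_x2 (b := - (a * a)) sS) => x y; rewrite sE !fE; ring.
by rewrite mulf_eq0 (negPf (natS_neq0 1)) (negPf a0).
Qed.

(** All finite levels lie in [Sop 0], so one witness serves them all. *)
Lemma Sdiff_shift_escapes n : shift_escapes (Sdiff n).
Proof.
move=> a /(Sop_shift_escapes 0)[f fA fS]; exists f => // s sS.
by apply/fS/Somega_Sdiff; exists n.
Qed.

(** This is the centre of [V], read off from images of [x2]. Commuting with [x2 -> x2 + x3] forces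
    [k = 0]; commuting with [x3 -> x3 + 1] makes [f2] shift invariant, hence constant. *)
Lemma mod_elem1_center f1 f2 k : poly_in [:: 2; 3] f1 -> poly_in [:: 3] f2 ->
  (forall h, in_U3 h -> exists2 f, inA2 f & comm (unitri f1 f2 k) h = elem1 f) ->
  k = 0 /\ exists a, f2 = a%:A.
Proof.
move=> f1P f2P gC; set g := unitri f1 f2 k in gC.
have gU : in_U3 g by apply/in_U3P; exists f1, f2, k.
have ff2 := poly_in_finsupp f2P; have fX2 := finsupp_var K 2.
have gh2 h : in_U3 h -> nceval (env g) (im2 h) = nceval (env h) (im2 g).
  move=> hU; have [f fA /(comm_eqP gU hU (finaut_U3 (in_U3_elem1 fA)))] := gC h hU.
  move=> /(congr1 (fun u => env u 2)).
  by rewrite !env_mul nceval_var env_mul.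
have P0 := poly_in0 K; have PX : poly_in [:: 3] (X 3) by exact: poly_in_var.
split.
  have hU : in_U3 (unitri 0 (X 3) 0) by apply/in_U3P; exists 0, (X 3), 0.
  move: (gh2 _ hU); rewrite /= !ncevalD //; last exact: finsupp_var.
  rewrite !nceval_var /=.
  have -> : nceval (env (unitri 0 (X 3) 0)) f2 = f2.
    rewrite -[RHS]nceval_vars //; apply: (eq_nceval f2P) => i.
    by rewrite inE => /eqP->; rewrite /= scale0r addr0.
  rewrite addrACA => /addrI; rewrite -[RHS]addr0 => /addrI/eqP.
  by rewrite scaler_eq0 oner_eq0 orbF => /eqP.
have hU : in_U3 (unitri 0 0 (1 : K)) by apply/in_U3P; exists 0, 0, 1.
move: (gh2 _ hU); rewrite /= addr0 ncevalD // !nceval_var /= addr0 => /addrI f2S.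
have [p pE] := poly_in_hornerP f2P.
exists (p.[0]); rewrite pE {1}(shift_invariant_const (p := p)) ?horner_algC // => y.
rewrite -!(ev_horner 0) -pE {2}f2S ev_unitri ?ev0 ?addr0 //.
exact: poly_in3_inA2.
Qed.

(** One successor step shared by the finite levels and those beyond [omega]. Commutators of [g] lie
    among the [elem1], so [g] induces a central shift on [K<x2, x3>]; [shift_escapes] makes it
    trivial, and [comm_elem1] translates the rest. *)
Lemma hypercenter_step (P : Aut3 K -> Prop) (S : ncpoly K -> Prop) :
  (forall f, S f -> inA2 f) -> shift_escapes S ->
  (forall g, P g <-> exists f, S f /\ g = elem1 f) ->
  forall g, (in_U3 g /\ forall h, in_U3 h -> P (comm g h)) <->
    exists f, (inA2 f /\ forall q k, poly_in [:: 3] q -> S (actV q k f - f)) /\ g = elem1 f.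
Proof.
move=> SA Sesc PS g; split; last first.
  move=> [f [[fA fS] ->]]; split=> [|h hU]; first exact: in_U3_elem1.
  rewrite comm_elem1 //; apply/PS; eexists; split; last by reflexivity.
  have /in_U3P[h1 [h2 [k [_ h2P ->]]]] := in_U3_inv hU.
  by rewrite -actV_unitri //; apply: fS.
move=> [gU gP].
have gC h : in_U3 h -> exists2 f, S f & comm g h = elem1 f.
  by move=> /gP/PS[f [fS ->]]; exists f.
case/in_U3P: (gU) => f1 [f2 [k [f1P f2P gE]]].
have [k0 [a f2E]] : k = 0 /\ exists a, f2 = a%:A.
  apply: (mod_elem1_center f1P f2P) => h /gC[f fS]; rewrite -gE => ->.
  by exists f => //; exact: SA.
have a0 : a = 0.
  apply/eqP; apply: contraT => /Sesc[f fA fesc]; have fU := in_U3_elem1 fA.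
  have [s sS sE] := gC _ fU; have sA := SA _ sS.
  case: (fesc s sS) => x y.
  have [fs ff] := (poly_in_finsupp sA, poly_in_finsupp fA).
  (* Compare the images of [x1] in [g (elem1 f) = (elem1 f) g (elem1 s)]. *)
  have gsf : nceval (env g) s = nceval (env g) f - f.
    move: ((comm_eqP gU fU (finaut_U3 (in_U3_elem1 sA))).1 sE).
    move=> /(congr1 (fun u => env u 1)); rewrite !env_mul /= !ncevalD ?nceval_var //;
      try exact: finsupp_var.
    rewrite env_mul gE /= ncevalD ?nceval_var /=; [|exact: finsupp_var|exact: poly_in_finsupp f1P].
    rewrite nceval_elem1 //.
    have -> : nceval (env (mul (elem1 f) (unitri f1 f2 k))) s = nceval (env (unitri f1 f2 k)) s.
      apply: (eq_nceval sA) => i; rewrite !inE => /orP[] /eqP->; rewrite env_mul /= nceval_elem1 //.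
        by apply: poly_inD; [exact: poly_in_var | exact: poly_in3_inA2].
      by apply: poly_inD; [exact: poly_in_var | exact: poly_inA].
    by rewrite [X 1 + f + f1]addrAC -[RHS]addrA => /addrI->; rewrite [RHS]addrC addKr.
  (* On [K<x2, x3>], [g] is the shift of [x2] by [a], so evaluating at [x - a] undoes it. *)
  have evg t : inA2 t -> ev x y t = ev (x - a) y (nceval (env g) t).
    by move=> tA; rewrite gE ev_unitri // k0 addr0 f2E ev_alg subrK.
  rewrite (evg s) // gsf evB -?evg //.
  by apply: finsupp_nceval => //; apply: finaut_U3.
exists f1; have f2_0 : f2 = 0 by rewrite f2E a0 scale0r.
have g1 : g = elem1 f1 by rewrite gE f2_0 k0 elem1E.
split=> //; split=> // q l qP.
(* Commuting with the inverse of this automorphism cancels the inverse in [comm_elem1] and yields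
   exactly the difference for [(q, l)]. *)
have hU : in_U3 (unitri 0 q l) by apply/in_U3P; exists 0, q, l; split=> //; exact: poly_in0.
have [s sS] := gC _ (in_U3_inv hU).
rewrite g1 comm_elem1 //; last exact: in_U3_inv.
by rewrite inv_inv // -actV_unitri // => /elem1_inj->.
Qed.

Lemma Zfin_elem1 n g : Zfin n g <-> exists f, Sdiff n f /\ g = elem1 f.
Proof.
elim: n g => [|n IH] g.
  by split=> [->|[f [-> ->]]]; [exists 0; split|]; rewrite ?elem1_0.
exact: (hypercenter_step (@Sdiff_inA2 n) (@Sdiff_shift_escapes n) IH g).
Qed.

Lemma Sop_inA2 m f : Sop m f -> inA2 f.
Proof. by case: m => [/Somega_Sdiff[n /Sdiff_inA2]|m []]. Qed.

Lemma Zop_elem1 m g : Zop m g <-> exists f, Sop m f /\ g = elem1 f.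
Proof.
elim: m g => [|m IH] g.
  split=> [[n /Zfin_elem1[f [fS ->]]]|[f [/Somega_Sdiff[n fS] ->]]].
    by exists f; split=> //; apply/Somega_Sdiff; exists n.
  by exists n; apply/Zfin_elem1; exists f.
exact: (hypercenter_step (@Sop_inA2 m) (@Sop_shift_escapes m) IH g).
Qed.

(** Taking a difference lowers a finite level by one, or keeps zero at zero, so it stays inside the
    union. *)
Lemma Sop0_sub f : Sop 0 f -> Sop 1 f.
Proof.
move=> fS; split; first exact: Sop_inA2 fS.
case/Somega_Sdiff: fS => -[->|n [fA fS]] g k gP; apply/Somega_Sdiff.
  by exists 0; rewrite psubE /actV substE nceval0 subrr.
by exists n; apply: fS.
Qed.

End Evaluation.

Theorem theorem2 (K : fieldType) (charK0 : [pchar K] =i pred0)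
  (a : ord2w) (ha : a <> OFin 0) (g : Aut3 K) :
  Zord a g <->
  exists f1 : ncpoly K, Sord a f1 /\ g = mkAut3 (padd (@pvar K 1) f1) (@pvar K 2) (@pvar K 3).
Proof.
case: a ha => [[|n] //|m|] _ /=.
- have ZE := Zfin_elem1 charK0 n.+1 g.
  split=> [/ZE.1|] [f [fS gE]]; [|apply: ZE.2]; exists f; split=> //; exact/SfinE.
- exact: Zop_elem1.
split=> [[m /(Zop_elem1 charK0)[f [fS gE]]]|[f [[m [_ fS]] gE]]].
  (* [Z2omega] includes level [omega] itself while [S2omega] starts at [omega + 1], so the case
     [m = 0] is raised by one level. *)
  exists f; split=> //; case: m fS => [|m] fS; last by exists m.+1.
  by exists 1; split=> //; exact: Sop0_sub.
by exists m; apply/(Zop_elem1 charK0); exists f.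
Qed.
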